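(* Let $P$ be a torsion-free complex. Then the $\omega$-globular set $\mathrm{Cell}(P)$ of cells of $P$, with sources and targets $\partial^-,\partial^+$, identity operations $\mathrm{id}$ and composition operations $\ast$, is a strict $\omega$-category.
   Context: An $\omega$-hypergraph is a set $P$ with a partition $P=\bigsqcup_{n\in\mathbb{N}}P_n$ together with, for $n\in\mathbb{N}$ and $u\in P_{n+1}$, two finite subsets $u^-,u^+\subseteq P_n$. For $U\subseteq P$ and $\epsilon\in\{-,+\}$, $U^\epsilon=\bigcup_{u\in U}u^\epsilon$; also $U^\mp=U^-\setminus U^+$ and $U^\pm=U^+\setminus U^-$. A subset $U\subseteq P_n$ is fork-free if either $n=0$ and $|U|=1$, or $n>0$ and $u^\epsilon\cap v^\epsilon=\emptyset$ for all distinct $u,v\in U$ and all $\epsilon\in\{-,+\}$. For $U\subseteq P_n$, $\triangleleft_U$ is the transitive closure of the relation on $U$ relating $u$ to $v$ when $n\ge 1$ and $u^+\cap v^-\neq\emptyset$; for $V,W\subseteq U$, $V\triangleleft_U W$ means $v\triangleleft_U w$ for some $v\in V$, $w\in W$; a subset $V\subseteq U$ is a segment for $\triangleleft_U$ if $u_1,u_3\in V$ and $u_1\triangleleft_U u_2\triangleleft_U u_3$ imply $u_2\in V$. An $n$-pre-cell of $P$ is a tuple $X=(X_{0,-},X_{0,+},\ldots,X_{n-1,-},X_{n-1,+},X_n)$ of finite subsets $X_{i,\epsilon}\subseteq P_i$, $X_n\subseteq P_n$; one writes $X_{n,-}=X_{n,+}=X_n$. For $i<n$, $\partial^\epsilon_i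 X=(X_{0,-},X_{0,+},\ldots,X_{i-1,-},X_{i-1,+},X_{i,\epsilon})$. A finite set $M\subseteq P_{i+1}$ moves a finite $U\subseteq P_i$ to a finite $V\subseteq P_i$ if $U=(V\cup M^-)\setminus M^+$ and $V=(U\cup M^+)\setminus M^-$. An $n$-cell is an $n$-pre-cell such that $X_{i+1,\epsilon}$ moves $X_{i,-}$ to $X_{i,+}$ for $0\le i<n$, $\epsilon\in\{-,+\}$, and every $X_{i,\epsilon}$ ($0\le i\le n$) is fork-free. $\mathrm{Cell}(P)$ is the graded set of cells, with globular structure given by $\partial^-,\partial^+$. Operations: for an $n$-cell $X$, $\mathrm{id}^{n+1}(X)=(X_{0,-},X_{0,+},\ldots,X_{n-1,-},X_{n-1,+},X_n,X_n,\emptyset)$. For $i<n$ and $n$-cells $X,Y$ with $\partial^+_iX=\partial^-_iY$, $X\ast_iY$ is the $n$-pre-cell $Z$ with $Z_{j,\epsilon}=X_{j,\epsilon}$ for $j<i$, $Z_{i,-}=X_{i,-}$, $Z_{i,+}=Y_{i,+}$, and $Z_{j,\epsilon}=X_{j,\epsilon}\cup Y_{j,\epsilon}$ for $j>i$. For $u\in P_n$, the atom $\langle u\rangle$ is the $n$-pre-cell with $\langle u\rangle_{n,-}=\langle u\rangle_{n,+}=\{u\}$ and, for $j<n$, $\langle u\rangle_{j,-}=(\langle u\rangle_{j+1,-})^\mp$, $\langle u\rangle_{j,+}=(\langle u\rangle_{j+1,+})^\pm$. $P$ is a torsion-free complex if it satisfies: (non-emptiness) $u^-\ne\emptyset$ and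 $u^+\neq\emptyset$ for all $u\in P_n$, $n\ge1$; (acyclicity) $\triangleleft_{P_n}$ is irreflexive for all $n\geq 1$; (relevance) $\langle u\rangle$ is a cell for all $u\in P$; (segment) for all $k\in\mathbb N$, $u\in P_k$, $n<k$, every $n$-cell $X$ and $\epsilon\in\{-,+\}$, if $\langle u\rangle_{n,\epsilon}\subseteq X_n$ then $\langle u\rangle_{n,\epsilon}$ is a segment for $\triangleleft_{X_n}$; (torsion-freeness) there are no $n,k,l\ge1$ with $n<\min(k,l)$, $u\in P_k$, $v\in P_l$ and $n$-cell $X$ with $\langle u\rangle_{n,+}\subseteq X_n$, $\langle v\rangle_{n,-}\subseteq X_n$, $\langle u\rangle_{n,+}\cap\langle v\rangle_{n,-}=\emptyset$ and $\langle u\rangle_{n,+}\triangleleft_{X_n}\langle v\rangle_{n,-}\triangleleft_{X_n}\langle u\rangle_{n,+}$ (meaning $\langle u\rangle_{n,+}\triangleleft_{X_n}\langle v\rangle_{n,-}$ and $\langle v\rangle_{n,-}\triangleleft_{X_n}\langle u\rangle_{n,+}$). In a strict $\omega$-category, $x\ast_i y$ is defined exactly when $\partial^+_i x=\partial^-_i y$ (diagrammatic order). *)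

(* Defs.v *)
From Stdlib Require Import Relation_Operators.
From mathcomp Require Import all_boot finmap boolp.

Set Implicit Arguments.
Unset Strict Implicit.
Unset Printing Implicit Defensive.

Local Open Scope fset_scope.

(* Throughout, a sign is a boolean: false stands for - and true for +. *)

(* The partition of P is given as the family of its pieces P n, and
   face e u is the finite set u^e. *)
Record hypergraph := Hypergraph {
  piece :> nat -> choiceType;
  face : bool -> forall n, piece n.+1 -> {fset piece n}
}.

Section Hypergraph.
Variable P : hypergraph.

Definition faces (e : bool) n (U : {fset P n.+1}) : {fset P n} :=
  \bigcup_(u <- U) face e u.

(* border false U is U^- minus U^+, and border true U is U^+ minus U^-. *)
Definition border (e : bool) n (U : {fset P n.+1}) : {fset P n} :=
  faces e U `\` faces (~~ e) U.

Definition fork_free n : {fset P n} -> Prop :=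
  match n return {fset P n} -> Prop with
  | 0 => fun U => #|` U| = 1
  | m.+1 => fun U => forall u v, u \in U -> v \in U -> u <> v ->
      forall e, face e u `&` face e v = fset0
  end.

Definition tri_step n : P n -> P n -> Prop :=
  match n return P n -> P n -> Prop with
  | 0 => fun _ _ => False
  | m.+1 => fun u v => face true u `&` face false v <> fset0
  end.

(* U is an arbitrary predicate, as the relation is also used for the possibly
   infinite set of all elements of P n. *)
Definition tri n (U : {pred P n}) : P n -> P n -> Prop :=
  clos_trans (P n) (fun u v => [/\ u \in U, v \in U & tri_step u v]).

Definition tri_sets n (U : {pred P n}) (V W : {fset P n}) : Prop :=
  exists v w, [/\ v \in V, w \in W & tri U v w].

Definition segment n (U : {pred P n}) (V : {fset P n}) : Prop :=
  forall u1 u2 u3, u1 \in V -> u3 \in V -> tri U u1 u2 -> tri U u2 u3 ->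
    u2 \in V.

(* An n-pre-cell is encoded as a family X of finite sets indexed by all degrees
   and signs: the components X i e with i <= n are those of the tuple, both
   components of degree n being X_n, and the ones of degree > n, which are not
   part of the tuple, are set to fset0. *)
Definition set_family : Type := forall i, bool -> {fset P i}.

Definition is_precell n (X : set_family) : Prop :=
  X n false = X n true /\ forall i e, n < i -> X i e = fset0.

Definition moves i (M : {fset P i.+1}) (U V : {fset P i}) : Prop :=
  U = (V `|` faces false M) `\` faces true M /\
  V = (U `|` faces true M) `\` faces false M.

Definition is_cell n (X : set_family) : Prop :=
  [/\ is_precell n X,
      forall i e, i < n -> moves (X i.+1 e) (X i false) (X i true) &
      forall i e, i <= n -> fork_free (X i e)].

Record cell n := Cell { cell_val :> forall i, bool -> {fset P i}; cellP : is_cell n cell_val }.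

Definition bd_family (e : bool) i (X : set_family) : set_family := fun j e' =>
  if j < i then X j e' else if j == i then X j e else fset0.

Definition id_family n (X : set_family) : set_family := fun j e =>
  if j <= n then X j e else fset0.

Definition comp_family i (X Y : set_family) : set_family := fun j e =>
  if j < i then X j e
  else if j == i then (if e then Y j e else X j e)
  else X j e `|` Y j e.

(* U seen as a set of degree j; only meaningful for j = n, and fset0 otherwise. *)
Definition fset_cast n j (U : {fset P n}) : {fset P j} :=
  if @eqP _ n j is ReflectT eq_nj then ecast k {fset P k} eq_nj U else fset0.

(* The component of degree j of the family with U in degree n, fset0 above, and
   each component of degree < n being the e-border of the next one. *)
Fixpoint descend (e : bool) n : {fset P n} -> forall j, {fset P j} :=
  match n return {fset P n} -> forall j, {fset P j} with
  | 0 => fun U j => fset_cast j U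
  | m.+1 => fun U j =>
      if j <= m then descend e (border e U) j else fset_cast j U
  end.

Definition atom n (u : P n) : set_family := fun j e => descend e [fset u] j.

Record torsion_free_complex : Prop := TorsionFreeComplex {
  nonemptiness : forall n (u : P n.+1) e, face e u <> fset0;
  acyclicity : forall n, 0 < n -> forall u : P n, ~ tri predT u u;
  relevance : forall n (u : P n), is_cell n (atom u);
  segment_axiom : forall k (u : P k) n, n < k ->
    forall (X : cell n) e, atom u n e `<=` X n true ->
      segment (mem (X n true)) (atom u n e);
  torsion_freeness : ~ exists n k l (u : P k) (v : P l) (X : cell n),
    [/\ [/\ 0 < n, n < k & n < l],
        atom u n true `<=` X n true,
        atom v n false `<=` X n true,
        atom u n true `&` atom v n false = fset0 &
        tri_sets (mem (X n true)) (atom u n true) (atom v n false) /\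
        tri_sets (mem (X n true)) (atom v n false) (atom u n true)]
}.

Lemma fset_cast_id n (U : {fset P n}) : fset_cast n U = U.
Proof. by rewrite /fset_cast; case: eqP => // p; rewrite (eq_axiomK p). Qed.

Lemma fset_cast_neq n j (U : {fset P n}) : n <> j -> fset_cast j U = fset0.
Proof. by rewrite /fset_cast; case: eqP. Qed.

Lemma descend_top e n (U : {fset P n}) : descend e U n = U.
Proof. by case: n U => [|n] U /=; rewrite ?ltnn fset_cast_id. Qed.

Lemma descend_above e n (U : {fset P n}) j : n < j -> descend e U j = fset0.
Proof.
move=> lt_nj; have ne_nj : n <> j by move=> eq_nj; rewrite eq_nj ltnn in lt_nj.
by case: n U lt_nj ne_nj => [|n] U lt_nj ne_nj /=;
  rewrite 1?leqNgt ?(ltnW lt_nj) /= fset_cast_neq.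
Qed.

Lemma descend_below e n (U : {fset P n}) j :
  j < n -> descend e U j = border e (descend e U j.+1).
Proof.
elim: n U => [//|n IHn] U; rewrite ltnS => le_jn; rewrite [LHS]/= le_jn.
case: (ltnP j n) => [lt_jn|le_nj]; first by rewrite /= lt_jn IHn.
have eq_jn : j = n by apply/eqP; rewrite eqn_leq le_jn.
by subst j; rewrite !descend_top.
Qed.

Lemma atom_top n (u : P n) e : atom u n e = [fset u].
Proof. exact: descend_top. Qed.

Lemma atom_above n (u : P n) j e : n < j -> atom u j e = fset0.
Proof. exact: descend_above. Qed.

Lemma atom_below n (u : P n) j e :
  j < n -> atom u j e = border e (atom u j.+1 e).
Proof. exact: descend_below. Qed.

Lemma set_familyP (X Y : set_family) : (forall i e, X i e = Y i e) -> X = Y.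
Proof.
move=> eqXY; apply: functional_extensionality_dep => i.
by apply: functional_extensionality_dep => e.
Qed.

Lemma cell_inj n : injective (@cell_val n).
Proof.
by move=> [X cX] [Y cY] /= eqXY; subst Y; congr Cell; apply: Prop_irrelevance.
Qed.

Lemma bd_is_cell e i n (X : set_family) :
  i < n -> is_cell n X -> is_cell i (bd_family e i X).
Proof.
move=> lt_in [_ mvX ffX]; rewrite /bd_family; split=> [|j e' lt_ji|j e' le_ji].
- split=> [|j e' lt_ij]; first by rewrite ltnn eqxx.
  by rewrite ltnNge (ltnW lt_ij) gtn_eqF.
- have := mvX j; rewrite lt_ji; case: (ltngtP j.+1 i) lt_ji => // [lt_ji _|eq_ji _].
    by move=> /(_ e' (ltn_trans (ltnW lt_ji) lt_in)).
  by move=> /(_ e); apply; rewrite -eq_ji in lt_in; exact: ltnW.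
- case: ltngtP le_ji => // [lt_ji _|-> _]; apply: ffX; last exact: ltnW.
  exact: ltnW (ltn_trans lt_ji lt_in).
Qed.

Definition bd_cell e i n (lt_in : i < n) (X : cell n) : cell i :=
  Cell (bd_is_cell e lt_in (cellP X)).

Lemma bd_cellK e e' i j n (lt_ij : i < j) (lt_jn : j < n) (lt_in : i < n)
    (X : cell n) :
  bd_cell e lt_ij (bd_cell e' lt_jn X) = bd_cell e lt_in X.
Proof.
apply: cell_inj; apply: set_familyP => k e'' /=; rewrite /bd_family.
case: (ltngtP k i) => // [lt_ki|->]; last by rewrite lt_ij.
by rewrite (ltn_trans lt_ki lt_ij).
Qed.

End Hypergraph.

(* An omega-globular set, given with all the source and target operations
   from degree n to degree i < n rather than only those from n.+1 to n. *)
Record globular_set := GlobularSet {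
  gcell :> nat -> Type;
  bd : bool -> forall i n, i < n -> gcell n -> gcell i;
  bdK : forall e e' i j n (lt_ij : i < j) (lt_jn : j < n) (lt_in : i < n)
    (x : gcell n), bd e lt_ij (bd e' lt_jn x) = bd e lt_in x
}.

Definition Cell_globular_set (P : hypergraph) : globular_set :=
  @GlobularSet (@cell P) (@bd_cell P) (@bd_cellK P).

Fixpoint iter_id (G : globular_set) (cat_id : forall n, G n -> G n.+1)
    i k : G i -> G (k + i)%N :=
  match k return G i -> G (k + i)%N with
  | 0 => fun x => x
  | k'.+1 => fun x => cat_id (k' + i)%N (iter_id cat_id k' x)
  end.

(* The structure of a strict omega-category on a given omega-globular set.
   The compositions are partial: cat_comp takes a proof that the i-target of x is
   the i-source of y. Each law is stated for arbitrary proofs of the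
   composability conditions it involves; the conditions on boundaries,
   identities or composites of the given cells are consequences of those on the
   cells themselves, by bdK, bd_id and the three bd_comp laws. In the unit laws,
   n is written as k.+1 + i to express that i < n. *)
Record strict_omega_category (G : globular_set) := StrictOmegaCategory {
  cat_id : forall n, G n -> G n.+1;
  cat_comp : forall i n (lt_in : i < n) (x y : G n),
    bd true lt_in x = bd false lt_in y -> G n;
  bd_id : forall e n (lt_nn1 : n < n.+1) (x : G n), bd e lt_nn1 (cat_id x) = x;
  bd_comp_lt : forall e j i n (lt_ji : j < i) (lt_in : i < n) (lt_jn : j < n)
    (x y : G n) (xy : bd true lt_in x = bd false lt_in y),
    bd e lt_jn (cat_comp xy) = bd e lt_jn x /\
    bd e lt_jn (cat_comp xy) = bd e lt_jn y;
  bd_comp_eq : forall i n (lt_in : i < n)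
    (x y : G n) (xy : bd true lt_in x = bd false lt_in y),
    bd false lt_in (cat_comp xy) = bd false lt_in x /\
    bd true lt_in (cat_comp xy) = bd true lt_in y;
  bd_comp_gt : forall e i j n (lt_ij : i < j) (lt_jn : j < n) (lt_in : i < n)
    (x y : G n) (xy : bd true lt_in x = bd false lt_in y)
    (bxy : bd true lt_ij (bd e lt_jn x) = bd false lt_ij (bd e lt_jn y)),
    bd e lt_jn (cat_comp xy) = cat_comp bxy;
  comp_id_l : forall i k (lt_in : (i < k.+1 + i)%N)
    (x : G (k.+1 + i)%N)
    (ux : bd true lt_in (iter_id cat_id k.+1 (bd false lt_in x)) =
          bd false lt_in x),
    cat_comp ux = x;
  comp_id_r : forall i k (lt_in : (i < k.+1 + i)%N)
    (x : G (k.+1 + i)%N)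
    (xu : bd true lt_in x =
          bd false lt_in (iter_id cat_id k.+1 (bd true lt_in x))),
    cat_comp xu = x;
  comp_assoc : forall i n (lt_in : i < n) (x y z : G n)
    (xy : bd true lt_in x = bd false lt_in y)
    (yz : bd true lt_in y = bd false lt_in z)
    (xy_z : bd true lt_in (cat_comp xy) = bd false lt_in z)
    (x_yz : bd true lt_in x = bd false lt_in (cat_comp yz)),
    cat_comp xy_z = cat_comp x_yz;
  comp_exchange : forall i j n (lt_ij : i < j) (lt_jn : j < n) (lt_in : i < n)
    (x y x' y' : G n)
    (xy : bd true lt_in x = bd false lt_in y)
    (xy' : bd true lt_in x' = bd false lt_in y')
    (xx' : bd true lt_jn x = bd false lt_jn x')
    (yy' : bd true lt_jn y = bd false lt_jn y')
    (xy_xy' : bd true lt_jn (cat_comp xy) = bd false lt_jn (cat_comp xy'))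
    (xx'_yy' : bd true lt_in (cat_comp xx') = bd false lt_in (cat_comp yy')),
    cat_comp xy_xy' = cat_comp xx'_yy';
  id_comp : forall i n (lt_in : i < n) (lt_in1 : i < n.+1) (x y : G n)
    (xy : bd true lt_in x = bd false lt_in y)
    (ixy : bd true lt_in1 (cat_id x) = bd false lt_in1 (cat_id y)),
    cat_id (cat_comp xy) = cat_comp ixy
}.

Arguments cat_id {G} _ {n}.
Arguments cat_comp {G} _ {i n} lt_in x y _.

(* Main.v *)
Require Import Defs.
From mathcomp Require Import ssrbool ssrnat.
From Stdlib Require Import Relation_Operators.
From mathcomp Require Import all_boot finmap boolp.

Set Implicit Arguments.
Unset Strict Implicit.
Unset Printing Implicit Defensive.

Local Open Scope fset_scope.

(* Everything rests on gluing: if A is the top of an n-cell and G is a fork-free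
   set of degree n+1 with G^- minus G^+ contained in A, then G^+ is disjoint from
   A, and replacing G^- by G^+ in A yields again the top of an n-cell. By
   acyclicity one may add the elements of G one at a time. For a single x, the
   segment axiom splits the n-cell along degree n-1 as a composite of cells with
   tops L, x^- and R. By relevance x^+ moves what x^- moves, so gluing in degree
   n-1 gives a cell with top x^+, and the sought n-cell is the composite of the
   cells with tops L, x^+ and R. That such composites along degree n-1 are cells
   follows from gluing in degree n-1 and acyclicity; composites along lower
   degrees reduce to them by whiskering. *)

(** * Faces of finite sets, and minimal elements *)

Lemma facesP (P : hypergraph) e n (U : {fset P n.+1}) z :
  reflect (exists2 u, u \in U & z \in face e u) (z \in faces e U).
Proof.
rewrite /faces; apply: (iffP (bigfcupP _ _ _ _)) => [[u /andP[Uu _] zu]|[u Uu zu]];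
  exists u => //; by rewrite Uu.
Qed.

Lemma faces1 (P : hypergraph) e n (u : P n.+1) : faces e [fset u] = face e u.
Proof.
apply/fsetP=> z; apply/facesP/idP => [[v /fset1P -> //]|zu].
by exists u; rewrite ?fset11.
Qed.

Lemma facesU (P : hypergraph) e n (U V : {fset P n.+1}) :
  faces e (U `|` V) = faces e U `|` faces e V.
Proof.
apply/fsetP=> z; rewrite inE; apply/facesP/orP.
  move=> [u /fsetUP[] Uu zu]; [left|right]; apply/facesP; by exists u.
by move=> [] /facesP[u Uu zu]; exists u; rewrite // inE Uu ?orbT.
Qed.

Lemma faces0 (P : hypergraph) e n : faces e (fset0 : {fset P n.+1}) = fset0.
Proof. by apply/fsetP=> z; rewrite inE; apply/facesP => -[u]; rewrite inE. Qed.

Lemma face_neq0P (P : hypergraph) n (u v : P n.+1) z :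
  z \in face true u -> z \in face false v -> face true u `&` face false v <> fset0.
Proof. by move=> zu zv /fsetP/(_ z); rewrite !inE zu zv. Qed.

Lemma tri_predT (P : hypergraph) n (u v : P n.+1) z :
  z \in face true u -> z \in face false v -> tri predT u v.
Proof. by move=> zu zv; apply: t_step; split=> //; apply: face_neq0P zu zv. Qed.

(** Induction on the cardinal of [G]: the predecessors of [x] in [G] form a smaller set, as [x] is
    not among them, and by transitivity a minimal predecessor is minimal in [G]. *)
Lemma exists_minimal (T : choiceType) (r : T -> T -> Prop) (G : {fset T}) :
    (forall x y z, r x y -> r y z -> r x z) -> (forall x, ~ r x x) ->
  G <> fset0 -> exists2 x, x \in G & forall y, y \in G -> ~ r y x.
Proof.
move=> rT rI; have [k leGk] := ubnP #|`G|.
elim: k G leGk => // k IH G leGk /eqP/fset0Pn[x Gx].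
set H := [fset y in G | `[<r y x>]].
have HE y : (y \in H) = (y \in G) && `[<r y x>] by rewrite !inE.
have [H0|/eqP/IH] := eqVneq H fset0.
  by exists x => // y Gy ryx; have := HE y; rewrite H0 Gy inE; case: asboolP.
case=> [|y].
  rewrite (cardfsD1 x) Gx add1n ltnS in leGk; apply: leq_ltn_trans leGk.
  apply/fsubset_leq_card/fsubsetP=> y; rewrite HE !inE => /andP[->].
  by rewrite andbT => /asboolP ryx; apply/eqP=> eyx; apply: (rI x); rewrite -{1}eyx.
rewrite HE => /andP[Gy /asboolP ryx] miny; exists y => // z Gz rzy.
by apply: (miny z) => //; rewrite HE Gz; apply/asboolP; apply: rT ryx.
Qed.

(** * Moves, and cells presented by their top component *)

(** The only possible target of a move by [G] out of [A], by the second equation of [moves]. *)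
Definition act (P : hypergraph) n (A : {fset P n}) (G : {fset P n.+1}) :=
  (A `|` faces true G) `\` faces false G.

(* [caps X U] says that the family [X] below degree n, completed by [U] in
   degree n, is an n-cell. *)
Fixpoint caps (P : hypergraph) (X : set_family P) n : {fset P n} -> Prop :=
  match n return {fset P n} -> Prop with
  | 0 => @fork_free P 0
  | m.+1 => fun U => [/\ caps X (X m false), caps X (X m true),
      moves U (X m false) (X m true) & fork_free U]
  end.

(** The successor case of [caps] with the two components of degree [n] left free, so that cells can
    be cut and pasted along degree [n] over a fixed [X]. *)
Definition fills (P : hypergraph) (X : set_family P) n (A B : {fset P n})
    (M : {fset P n.+1}) : Prop :=
  [/\ caps X A, caps X B, moves M A B & fork_free M].

(** Degree 0 is excluded, since there the empty subset of a singleton is not fork-free. *)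
Lemma fork_freeS (P : hypergraph) n (U V : {fset P n.+1}) :
  V `<=` U -> fork_free U -> fork_free V.
Proof. by move=> /fsubsetP VU ffU u v /VU Uu /VU Uv; apply: ffU. Qed.

Lemma fork_free_eq (P : hypergraph) n (U : {fset P n.+1}) e u v z :
    fork_free U -> u \in U -> v \in U -> z \in face e u -> z \in face e v ->
  u = v.
Proof.
move=> ffU Uu Uv zu zv; apply: contrapT => neq_uv.
by have /fsetP/(_ z) := ffU u v Uu Uv neq_uv e; rewrite !inE zu zv.
Qed.

(** Pointwise form of [moves], which turns the set identities below into case analyses on
    booleans. *)
Lemma moves_mem (P : hypergraph) n (M : {fset P n.+1}) A B : moves M A B <->
  forall z,
  z \in A = ((z \in B) || (z \in faces false M)) && (z \notin faces true M) /\
  z \in B = ((z \in A) || (z \in faces true M)) && (z \notin faces false M).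
Proof.
split=> [[/fsetP eA /fsetP eB] z|eAB].
  by move: (eA z) (eB z); rewrite !inE ![_ && (_ || _)]andbC.
by split; apply/fsetP=> z; have [eA eB] := eAB z; rewrite !inE andbC.
Qed.

Lemma border_mem (P : hypergraph) n e (G : {fset P n.+1}) (A : {fset P n}) z :
  border e G `<=` A -> z \in faces e G -> (z \in A) || (z \in faces (~~ e) G).
Proof.
move=> /fsubsetP/(_ z); rewrite inE => sGA zG.
by case: (z \in faces (~~ e) G) sGA; rewrite ?orbT // zG orbF; apply.
Qed.

Lemma in_act (P : hypergraph) n (A : {fset P n}) (G : {fset P n.+1}) z :
  z \in act A G =
  ((z \in A) || (z \in faces true G)) && (z \notin faces false G).
Proof. by rewrite !inE andbC. Qed.

(** The second equation of [moves] is the definition of [act]; the first one, which recovers [A],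
    uses both hypotheses. *)
Lemma moves_act (P : hypergraph) n (A : {fset P n}) (G : {fset P n.+1}) :
    border false G `<=` A -> faces true G `&` A = fset0 ->
  moves G A (act A G).
Proof.
move=> sGA /fsetP dGA; split=> //; apply/fsetP=> z.
have := dGA z; have := @border_mem _ _ _ _ _ z sGA; rewrite !inE /=.
by do !case: (z \in _) => //=; move=> /(_ isT).
Qed.

Lemma moves_border (P : hypergraph) n (M : {fset P n.+1}) A B :
  moves M A B -> border false M `<=` A.
Proof.
move=> mvM; apply/fsubsetP=> z; have [] := (moves_mem _ _ _).1 mvM z; rewrite inE.
by do !case: (z \in _).
Qed.

(** * Splitting a move into successive moves *)

(** Expresses that [S] can be performed before the rest of [M]. *)
Definition initial (P : hypergraph) n (S M : {fset P n.+1}) : Prop :=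
  forall s m z, s \in S -> m \in M -> z \in face true m -> z \in face false s ->
    m \in S.

(** A face consumed but not produced by [S] is not produced by [M] either, since its producer would
    lie in [S]; so it must be present in [A] from the start. *)
Lemma initial_border (P : hypergraph) n (S M : {fset P n.+1}) A B :
    moves M A B -> S `<=` M -> initial S M -> border false S `<=` A.
Proof.
move=> mvM /fsubsetP sSM iniS; apply/fsubsetP=> z; rewrite inE.
case/andP=> zNS /facesP[s Ss zs].
have zM : z \in faces false M by apply/facesP; exists s => //; apply: sSM.
have [-> _] := (moves_mem _ _ _).1 mvM z; rewrite zM orbT /=.
apply: contraNN zNS => /facesP[m Mm zm]; apply/facesP; exists m => //.
exact: iniS Ss Mm zm zs.
Qed.

Lemma faces_disjoint (P : hypergraph) n (S M : {fset P n.+1}) e z :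
    fork_free M -> S `<=` M ->
  ~~ ((z \in faces e S) && (z \in faces e (M `\` S))).
Proof.
move=> ffM /fsubsetP sSM; apply/negP=> /andP[/facesP[u Su zu] /facesP[v]].
rewrite inE => /andP[vNS Mv] zv; move: vNS.
by rewrite -(fork_free_eq ffM (sSM _ Su) Mv zu zv) Su.
Qed.

Lemma fsubset_split (T : choiceType) (S M : {fset T}) :
  S `<=` M -> M = S `|` (M `\` S).
Proof.
move=> /fsubsetP sSM; apply/fsetP=> z; have := sSM z; rewrite !inE.
by do !case: (z \in _) => // /(_ isT).
Qed.

Lemma moves_split (P : hypergraph) n (S M : {fset P n.+1}) A B :
    moves M A B -> fork_free M -> S `<=` M -> initial S M ->
    faces true S `&` A = fset0 ->
  moves S A (act A S) /\ moves (M `\` S) (act A S) B.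
Proof.
move=> mvM ffM sSM iniS dSA; split.
  by apply: moves_act => //; apply: initial_border mvM _ _.
(* By initiality, the remaining elements produce nothing that [S] consumes. *)
have dF : forall z, ~~ ((z \in faces false S) && (z \in faces true (M `\` S))).
  move=> z; apply/negP=> /andP[/facesP[s Ss zs] /facesP[m]].
  rewrite inE => /andP[mNS Mm zm]; move: mNS.
  by rewrite (iniS s m z).
apply/moves_mem=> z; rewrite in_act.
have := dF z; have := faces_disjoint false z ffM sSM.
have := faces_disjoint true z ffM sSM.
have := (moves_mem _ _ _).1 mvM z; move: dSA => /fsetP/(_ z).
have eM e : (z \in faces e M) = (z \in faces e S) || (z \in faces e (M `\` S)).
  by rewrite {1}(fsubset_split sSM) facesU in_fsetU.
rewrite !eM in_fsetI in_fset0.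
move: (z \in A) (z \in B) (z \in faces true S) (z \in faces false S)
  (z \in faces true (M `\` S)) (z \in faces false (M `\` S)).
by do 6!case=> //=; move=> _ [].

Qed.

(** * Gluing, and its use for cutting and pasting cells along the next lower degree *)

Definition gluing (P : hypergraph) (X : set_family P) n : Prop :=
  forall (A : {fset P n}) (G : {fset P n.+1}), caps X A -> fork_free G ->
    border false G `<=` A -> faces true G `&` A = fset0 /\ caps X (act A G).

(** Gluing [S] onto [A] makes the intermediate stage [act A S] the top of a cell, and gives the
    disjointness needed to split the move. *)
Lemma fills_split (P : hypergraph) (X : set_family P) n (A B : {fset P n}) S M :
    gluing X n -> fills X A B M -> S `<=` M -> initial S M ->
  fills X A (act A S) S /\ fills X (act A S) B (M `\` S).
Proof.
move=> gX [cA cB mvM ffM] sSM iniS.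
have ffS := fork_freeS sSM ffM.
have [dSA cAS] := gX A S cA ffS (initial_border mvM sSM iniS).
have [mvS mvMS] := moves_split mvM ffM sSM iniS dSA.
by split; split=> //; apply: fork_freeS ffM; apply: fsubsetDl.
Qed.

Lemma fills_glue (P : hypergraph) (X : set_family P) n (A : {fset P n}) G :
    gluing X n -> caps X A -> fork_free G -> border false G `<=` A ->
  faces true G `&` A = fset0 /\ fills X A (act A G) G.
Proof.
move=> gX cA ffG sGA; have [dGA cAG] := gX A G cA ffG sGA.
by split=> //; split=> //; apply: moves_act.
Qed.

(* If z is consumed by x in M and produced by y in N, then everything on which
   x or y depends can be glued without x, so that y^+ meets a cell on which y
   is glueable. *)
Lemma fills_faces_disjoint (P : hypergraph) (hP : torsion_free_complex P)
    (X : set_family P) n (A B C : {fset P n}) M N :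
    gluing X n -> fills X A B M -> fills X B C N ->
  faces false M `&` faces true N = fset0.
Proof.
move=> gX [cA cB mvM ffM] [_ cC mvN ffN].
apply/fsetP=> z; rewrite in_fset0 in_fsetI; apply/negP=> /andP[zM].
case/facesP=> y Ny zy; have /facesP[x Mx zx] := zM.
pose r : P n.+1 -> P n.+1 -> Prop := tri predT.
have rT u v w : r u v -> r v w -> r u w by apply: t_trans.
have rI u : ~ r u u by apply: acyclicity.
have ryx : r y x by apply: tri_predT zy zx.
pose S := [fset m in M | `[<r m x \/ r m y>]].
pose T := [fset m in N | `[<m = y \/ r m y>]].
have SE m : (m \in S) = (m \in M) && `[<r m x \/ r m y>] by rewrite !inE.
have TE m : (m \in T) = (m \in N) && `[<m = y \/ r m y>] by rewrite !inE.
have sSM : S `<=` M by apply/fsubsetP=> m; rewrite SE => /andP[].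
have sTN : T `<=` N by apply/fsubsetP=> m; rewrite TE => /andP[].
have iniS : initial S M.
  move=> s m w; rewrite !SE => /andP[_ /asboolP rs] -> wm ws /=.
  apply/asboolP; have rms : r m s by apply: tri_predT wm ws.
  by case: rs => ?; [left|right]; apply: rT rms _.
have [_ cAS] := gX A S cA (fork_freeS sSM ffM) (initial_border mvM sSM iniS).
(* A face [w] consumed but not produced by [T] is not produced by [N], so it lies in [B]. Hence it
   is not consumed by [M], and it lies in [A] or is produced by an element of [M] below [y], which
   is in [S]. *)
have sT_AS : border false T `<=` act A S.
  apply/fsubsetP=> w; rewrite in_fsetD => /andP[wNT /facesP[t Tt wt]].
  have := Tt; rewrite TE => /andP[Nt /asboolP rt].
  have wB : w \in B.
    have [-> _] := (moves_mem _ _ _).1 mvN w.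
    have -> : w \in faces false N by apply/facesP; exists t.
    rewrite orbT; apply: contraNN wNT => /facesP[u Nu wu].
    apply/facesP; exists u => //; rewrite TE Nu; apply/asboolP; right.
    have rut : r u t by apply: tri_predT wu wt.
    by case: rt => [<-//|]; apply: rT.
  have [_] := (moves_mem _ _ _).1 mvM w; rewrite wB in_act => /esym/andP[wA wNM].
  apply/andP; split; last first.
    apply: contraNN wNM => /facesP[s Ss ws]; apply/facesP; exists s => //.
    by move/fsubsetP: sSM; apply.
  case/orP: wA => [->//|/facesP[m Mm wm]]; apply/orP; right.
  apply/facesP; exists m => //; rewrite SE Mm; apply/asboolP; right.
  have rmt : r m t by apply: tri_predT wm wt.
  by case: rt => [<-//|]; apply: rT.
have [/fsetP/(_ z) dT _] := gX _ T cAS (fork_freeS sTN ffN) sT_AS.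
have zT : z \in faces true T.
  by apply/facesP; exists y => //; rewrite TE Ny; apply/asboolP; left.
(* The contradiction is that [z] lies in [act A S]: its only consumer [x] in [M] is not in [S], by
   acyclicity, and a producer of [z] in [M] is below [x], hence in [S]. *)
move: dT; rewrite in_fset0 in_fsetI zT in_act /= => /negP[].
apply/andP; split; last first.
  apply/negP=> /facesP[s]; rewrite SE => /andP[Ms /asboolP rs] zs.
  have eq_sx := fork_free_eq ffM Ms Mx zs zx.
  rewrite eq_sx in rs; case: rs => [|rxy]; first exact: rI.
  by apply: (rI x); apply: rT rxy ryx.
have [zA _] := (moves_mem _ _ _).1 mvM z; rewrite {}zA zM orbT /=.
have [/facesP[m Mm zm]|//] := boolP (z \in faces true M).
apply/facesP; exists m => //; rewrite SE Mm; apply/asboolP; left.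
exact: tri_predT zm zx.
Qed.

(** A face shared by [M] and [N] with the same sign would, by the two moves through [B], be consumed
    by [M] and produced by [N]. So there are no forks between [M] and [N], and by non-emptiness of
    faces no common element. *)
Lemma fills_comp (P : hypergraph) (hP : torsion_free_complex P)
    (X : set_family P) n (A B C : {fset P n}) M N :
    gluing X n -> fills X A B M -> fills X B C N ->
  M `&` N = fset0 /\ fills X A C (M `|` N).
Proof.
move=> gX fM fN; have /fsetP dMN := fills_faces_disjoint hP gX fM fN.
have [cA cB mvM ffM] := fM; have [_ cC mvN ffN] := fN.
have dF e z : ~~ ((z \in faces e M) && (z \in faces e N)).
  have := dMN z; have := (moves_mem _ _ _).1 mvN z.
  have := (moves_mem _ _ _).1 mvM z; rewrite in_fset0 in_fsetI.
  case: e; move: (z \in A) (z \in B) (z \in C) (z \in faces true M)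
   (z \in faces false M) (z \in faces true N) (z \in faces false N);
  by do 7!case=> //=; move=> -[? ?] [? ?].
have dF' u v e z : u \in M -> v \in N -> z \in face e u -> z \in face e v -> False.
  move=> Mu Nv zu zv; have /negP[] := dF e z.
  by apply/andP; split; apply/facesP; [exists u|exists v].
split.
  apply/fsetP=> u; rewrite in_fset0 in_fsetI; apply/negP=> /andP[Mu Nu].
  have /eqP/fset0Pn[z zu] := @nonemptiness _ hP _ u false.
  exact: (dF' _ _ _ _ Mu Nu zu zu).
split=> //.
  apply/moves_mem=> z; have := dMN z; have := (moves_mem _ _ _).1 mvN z.
  have := (moves_mem _ _ _).1 mvM z; have := dF true z; have := dF false z.
  rewrite !facesU in_fset0 in_fsetI !in_fsetU.
  move: (z \in A) (z \in B) (z \in C) (z \in faces true M)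
   (z \in faces false M) (z \in faces true N) (z \in faces false N).
  by do 7!case=> //=; move=> ? ? [? ?] [? ?].
move=> u v /fsetUP[] Uu /fsetUP[] Uv neq_uv e; [exact: ffM| | |exact: ffN];
  apply/fsetP=> z; rewrite in_fset0 in_fsetI; apply/negP=> /andP[zu zv].
  exact: (dF' _ _ _ _ Uu Uv zu zv).
exact: (dF' _ _ _ _ Uv Uu zv zu).
Qed.

(** * Faces of atoms, and passage between [caps] and [is_cell] *)

Lemma face_disjoint (P : hypergraph) (hP : torsion_free_complex P) n
    (x : P n.+1) z :
  ~~ ((z \in face true x) && (z \in face false x)).
Proof.
apply/negP=> /andP[zt zf]; apply: (@acyclicity _ hP _ _ x) => //.
exact: tri_predT zt zf.
Qed.

(** By acyclicity no face of [x] has both signs, so taking the border removes nothing. *)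
Lemma atom_face (P : hypergraph) (hP : torsion_free_complex P) n
    (x : P n.+1) e : atom x n e = face e x.
Proof.
rewrite atom_below // atom_top /border !faces1; apply/fsetP=> z.
rewrite in_fsetD; have := face_disjoint hP x z.
by case: e => /=; move: (z \in face true x) (z \in face false x) => [] [].
Qed.

Lemma caps_eq_below (P : hypergraph) (X Y : set_family P) n (U : {fset P n}) :
  (forall i e, i < n -> X i e = Y i e) -> caps X U -> caps Y U.
Proof.
elim: n U => //= n IHn U eqXY [cA cB mvU ffU].
by split=> //; rewrite -!eqXY //;
  by apply: IHn => // i e lt_in; apply: eqXY; apply: ltnW.
Qed.

(** Unfolding [caps] visits the components of both signs in every lower degree, and so collects all
    the conditions on moves and forks. *)
Lemma is_cell_caps (P : hypergraph) (X : set_family P) n :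
  is_cell n X <-> is_precell n X /\ forall e, caps X (X n e).
Proof.
suff capsE m : (forall e, caps X (X m e)) <->
    (forall i e, i < m -> moves (X i.+1 e) (X i false) (X i true)) /\
    (forall i e, i <= m -> fork_free (X i e)).
  split=> [[pX mvX ffX]|[pX /capsE[]]]; last by split.
  by split=> //; apply/capsE.
elim: m => [|m [IH1 IH2]] /=.
  split=> [ffX|[_ ffX] e]; last exact: (ffX 0 e).
  by split=> // i e; rewrite leqn0 => /eqP->.
split=> [cX|[mvX ffX] e].
  have [|mvX ffX] := IH1.
    by case; [case: (cX true)|case: (cX false)].
  split=> i e; [rewrite ltnS|]; rewrite leq_eqVlt => /orP[/eqP->|];
    by [case: (cX e)|apply: mvX|apply: ffX].
have cX : forall e, caps X (X m e).
  by apply: IH2; split=> i e' le_im; [apply: mvX|apply: ffX]; apply: ltnW.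
by split; [exact: cX|exact: cX|exact: mvX|exact: (ffX m.+1 e)].
Qed.

(** Makes the segment axiom, which speaks of cells, available for [caps]. *)
Lemma caps_cell (P : hypergraph) (X : set_family P) n (U : {fset P n}) :
  caps X U -> exists Y : cell P n, Y n true = U.
Proof.
move=> cU; pose Y : set_family P := fun j e => if j < n then X j e else fset_cast j U.
have YnE e : Y n e = U by rewrite /Y ltnn fset_cast_id.
have cY : is_cell n Y.
  apply/is_cell_caps; split=> [|e]; last first.
    by rewrite YnE; apply: caps_eq_below cU => i e' lt_in; rewrite /Y lt_in.
  split=> [|i e lt_ni]; first by rewrite !YnE.
  rewrite /Y ltnNge (ltnW lt_ni) fset_cast_neq // => eq_ni.
  by rewrite eq_ni ltnn in lt_ni.
by exists (Cell cY); apply: YnE.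
Qed.

(** * Proof of the gluing property by induction on the degree *)

Definition gluing1 (P : hypergraph) (X : set_family P) n : Prop :=
  forall (A : {fset P n}) x, caps X A -> face false x `<=` A ->
    face true x `&` A = fset0 /\ caps X (act A [fset x]).

(** Induction on the cardinal of [G]: nothing in [G] produces a face consumed by a minimal [x], so
    [x] can be glued first and the rest of [G] afterwards. *)
Lemma gluing1_gluing (P : hypergraph) (hP : torsion_free_complex P)
    (X : set_family P) n :
  gluing1 X n -> gluing X n.
Proof.
move=> g1 A G; have [k leGk] := ubnP #|`G|.
elim: k A G leGk => // k IHk A G leGk cA ffG sGA.
have [G0|/eqP neqG0] := eqVneq G fset0.
  rewrite G0 /act !faces0 fset0I fsetU0 fsetD0; by split.
have [|u|x Gx minx] := exists_minimal (r := tri (P := P) predT) _ _ neqG0.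
- by move=> u v w; apply: t_trans.
- exact: acyclicity.
pose H := G `\ x.
have GE : G = x |` H by rewrite fsetD1K.
have GfE e z : (z \in faces e G) = (z \in face e x) || (z \in faces e H).
  by rewrite GE facesU faces1 in_fsetU.
have sHG : H `<=` G by apply: fsubD1set.
have dF z : ~~ ((z \in face false x) && (z \in faces true G)).
  apply/negP=> /andP[zx /facesP[y Gy zy]]; apply: (minx y Gy).
  exact: tri_predT zy zx.
have dX e z : ~~ ((z \in face e x) && (z \in faces e H)).
  have := faces_disjoint e z ffG (_ : [fset x] `<=` G).
  by rewrite faces1; apply; rewrite fsub1set.
have sxA : face false x `<=` A.
  apply/fsubsetP=> z zx; have := dF z; have := border_mem (z := z) sGA.
  by rewrite GfE zx => /(_ isT) /orP[//|->].
have [/fsetP dxA cA'] := g1 A x cA sxA.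
have in_A' z : z \in act A [fset x] =
    ((z \in A) || (z \in face true x)) && (z \notin face false x).
  by rewrite in_act !faces1.
have [|||/fsetP dH cH] := IHk (act A [fset x]) H _ cA'.
- by move: leGk; rewrite (cardfsD1 x) Gx.
- exact: fork_freeS ffG.
- apply/fsubsetP=> z; rewrite in_fsetD in_A' => /andP[zNH zH].
  have := border_mem (z := z) sGA; have := dX false z; rewrite !GfE zH orbT /=.
  by rewrite (negPf zNH) orbF andbT => -> /(_ isT) ->.
split.
  apply/fsetP=> z; rewrite in_fset0 in_fsetI.
  have := dH z; have := dxA z; have := dF z.
  rewrite !in_fset0 !in_fsetI in_A' GfE.
  move: (z \in A) (z \in face true x) (z \in face false x) (z \in faces true H).
  by do 4!case.
(* The two sides could differ only at a face consumed by [x] and produced by [H], which [dF]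
   excludes. *)
suff -> : act A G = act (act A [fset x]) H by [].
apply/fsetP=> z; rewrite 2!in_act in_A' !GfE.
have := dF z; rewrite GfE.
move: (z \in A) (z \in face true x) (z \in face false x) (z \in faces true H)
  (z \in faces false H).
by do 5!case.
Qed.

(** Since [A] is a singleton and x^- is non-empty, x^- is all of [A]; gluing yields x^+, a singleton
    by relevance. *)
Lemma gluing1_0 (P : hypergraph) (hP : torsion_free_complex P)
    (X : set_family P) : gluing1 X 0.
Proof.
move=> A x /= /eqP/cardfs1P[a ->] sxa.
have fx : face false x = [fset a].
  have /eqP/fset0Pn[z zx] := @nonemptiness _ hP _ x false.
  apply/fsetP=> w; rewrite in_fset1; have /fsubsetP sx := sxa.
  apply/idP/eqP=> [/sx/fset1P//|->].
  by have /fset1P <- := sx z zx.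
have dx := face_disjoint hP x.
have actE : act [fset a] [fset x] = face true x.
  apply/fsetP=> z; rewrite in_act !faces1 -fx; have := dx z.
  by do 2!case: (z \in face _ _).
split.
  apply/fsetP=> z; rewrite -fx in_fset0 in_fsetI; exact/negbTE/dx.
rewrite actE -(atom_face hP).
by have [_ _ /(_ 0 true isT)] := relevance hP x.
Qed.

Lemma gluing1S (P : hypergraph) (hP : torsion_free_complex P)
    (X : set_family P) n :
  gluing X n -> gluing1 X n.+1.
Proof.
move=> gX U x cU sKU.
have fU : fills X (X n false) (X n true) U by exact: cU.
have [Y YU] := caps_cell cU.
have segK : segment (mem U) (face false x).
  have := @segment_axiom _ hP _ x _ (ltnSn n.+1) Y false.
  by rewrite YU (atom_face hP); apply.
have [_ mvx ffx] := relevance hP x.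
have mvK e : moves (face e x) (atom x n false) (atom x n true).
  by rewrite -(atom_face hP); apply: mvx.
have ffK' : fork_free (face true x) by rewrite -(atom_face hP); apply: ffx.
have dK := face_disjoint hP x.
have bK : atom x n false = border false (face false x).
  by rewrite atom_below // (atom_face hP).
(* From here on [K] is x^- and [K'] is x^+; both move [atom x n false] to [atom x n true]. *)
move: (face false x) (face true x) bK (mvK false) (mvK true) segK sKU ffK' dK
  (faces1 false x) (faces1 true x).
move=> K K' bK mvK1 mvK' segK sKU ffK' dK eK eK'.
have [cA cB _ _] := fU.
have trU u v z : u \in U -> v \in U -> z \in face true u -> z \in face false v ->
    tri (mem U) u v.
  by move=> Uu Uv zu zv; apply: t_step; split=> //; apply: face_neq0P zu zv.
pose below v := exists2 w, w \in K & tri (mem U) v w.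
(* [L] collects what must precede [K]. It is initial by the segment property: an element of [K] just
   before one of [L] would place the latter between two elements of [K]. *)
pose L := [fset v in U | (v \notin K) && `[<below v>]].
have LE v : (v \in L) = [&& v \in U, v \notin K & `[<below v>]] by rewrite !inE.
have sLU : L `<=` U by apply/fsubsetP=> v; rewrite LE => /and3P[].
have inKU u : u \in K -> u \in U by move/fsubsetP: sKU; apply.
have iniL : initial L U.
  move=> l u z; rewrite !LE => /and3P[Ul lNK /asboolP[w Kw lw]] Uu zu zl.
  have ul := trU _ _ _ Uu Ul zu zl; rewrite Uu /=; apply/andP; split.
    by apply: contraNN lNK => Ku; apply: segK Ku Kw ul lw.
  by apply/asboolP; exists w => //; apply: t_trans ul lw.
have [fL fLR] := fills_split gX fU sLU iniL.
have sKUL : K `<=` U `\` L.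
  by apply/fsubsetP=> u Ku; rewrite in_fsetD LE Ku inKU ?andbF.
have iniK : initial K (U `\` L).
  move=> k u z Kk; rewrite in_fsetD LE => /andP[uNL Uu] zu zk.
  apply: contraNT uNL => uNK; rewrite Uu uNK; apply/asboolP; exists k => //.
  exact: trU Uu (inKU _ Kk) zu zk.
have [fK fR] := fills_split gX fLR sKUL iniK.
move: (act _ L) fL fLR fK fR => B1 fL fLR fK fR.
have [_ cB1 _ _] := fL; have [_ _ mvB _] := fK.
(* [B1] is the stage after [L], where [K] can start; it contains the source of [K], which is also
   that of [K'], so [K'] can be glued there. *)
have sDB1 : atom x n false `<=` B1 by rewrite bK; apply: moves_border mvB.
have [/fsetP dK'B1 fK'] := fills_glue gX cB1 ffK'
  (fsubset_trans (moves_border mvK') sDB1).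
(* Both replace [atom x n false] by [atom x n true] inside [B1], so the rest of [U] can follow [K']
   as it followed [K]. *)
have eB2 : act B1 K' = act B1 K.
  apply/fsetP=> z; rewrite !in_act; move/fsubsetP/(_ z): sDB1.
  have := (moves_mem _ _ _).1 mvB z; have := dK'B1 z.
  have := (moves_mem _ _ _).1 mvK1 z; have := (moves_mem _ _ _).1 mvK' z.
  rewrite in_fset0 in_fsetI in_act.
  move: (z \in B1) (z \in atom x n false) (z \in atom x n true)
    (z \in faces false K) (z \in faces true K)
    (z \in faces false K') (z \in faces true K').
  by do 7!case=> //=; move=> -[? ?] [? ?] ? [? ?] // /(_ isT).
rewrite eB2 in fK'.
have [/fsetP dLK' fLK'] := fills_comp hP gX fL fK'.
have [/fsetP dR [_ _ mvU' ffU']] := fills_comp hP gX fLK' fR.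
(* Of the three parts of [U], [K] misses [K'] by acyclicity, and the other two by the disjointness
   in [fills_comp]. *)
have dU z : ~~ ((z \in K') && (z \in U)).
  have := dK z; have := dLK' z; have := dR z.
  rewrite !in_fset0 !in_fsetI !in_fsetU !in_fsetD.
  by move: (z \in K) (z \in K') (z \in L) (z \in U); do 4!case.
split.
  by apply/fsetP=> z; rewrite in_fset0 in_fsetI; apply/negbTE/dU.
suff -> : act U [fset x] = (L `|` K') `|` ((U `\` L) `\` K) by split.
apply/fsetP=> z; rewrite in_act eK eK' !in_fsetU !in_fsetD LE.
have := dK z; have := dU z; have /implyP := inKU z.
by move: (z \in K) (z \in K') (z \in U) (asbool _); do 4!case.
Qed.

Lemma gluing_holds (P : hypergraph) (hP : torsion_free_complex P)
    (X : set_family P) n : gluing X n.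
Proof.
elim: n => [|n IHn]; apply: gluing1_gluing => //; first exact: gluing1_0.
exact: gluing1S.
Qed.

(** * Composites along an arbitrary degree are cells *)

Definition composable (P : hypergraph) i (X Y : set_family P) : Prop :=
  (forall j e, j < i -> X j e = Y j e) /\ X i true = Y i false.

Lemma bd_composable (P : hypergraph) i (X Y : set_family P) :
  bd_family true i X = bd_family false i Y -> composable i X Y.
Proof.
move=> eqXY; have XYE j e : bd_family true i X j e = bd_family false i Y j e.
  by rewrite eqXY.
split=> [j e lt_ji|]; first by have := XYE j e; rewrite /bd_family lt_ji.
by have := XYE i true; rewrite /bd_family ltnn eqxx.
Qed.

Lemma comp_family_gt (P : hypergraph) i j (X Y : set_family P) e :
  i < j -> comp_family i X Y j e = X j e `|` Y j e.
Proof. by move=> lt_ij; rewrite /comp_family ltnNge (ltnW lt_ij) gtn_eqF. Qed.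

Lemma bd_family_top (P : hypergraph) e i (X : set_family P) e' :
  bd_family e i X i e' = X i e.
Proof. by rewrite /bd_family ltnn eqxx. Qed.

Lemma bd_family_lt (P : hypergraph) e i j (X : set_family P) e' :
  j < i -> bd_family e i X j e' = X j e'.
Proof. by rewrite /bd_family => ->. Qed.

(** The top of [X] is performed first, leaving [Y n false] at rest, then the top of [Y], leaving
    [X n true] at rest; disjointness in degree [n] keeps the resting part untouched. The two
    whiskerings are pasted by [fills_comp]. *)
Lemma fills_family_comp (P : hypergraph) (hP : torsion_free_complex P)
    (X Y Z : set_family P) n :
    caps X (X n.+1 true) -> caps Y (Y n.+1 true) ->
    (forall e, caps Z (X n e `|` Y n e)) ->
    (forall e e', X n e `&` Y n e' = fset0) ->
  X n.+1 true `&` Y n.+1 true = fset0 /\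
  fills Z (X n false `|` Y n false) (X n true `|` Y n true)
    (X n.+1 true `|` Y n.+1 true).
Proof.
move=> [_ _ mvX ffX] [_ _ mvY ffY] cZ dXY.
have gZ := @gluing_holds _ hP Z n.
move: (X n.+1 true) (Y n.+1 true) mvX mvY ffX ffY => M N mvM mvN ffM ffN.
have [|/fsetP dM fM] := fills_glue gZ (cZ false) ffM.
  exact: fsubset_trans (moves_border mvM) (fsubsetUl _ _).
have eT : act (X n false `|` Y n false) M = X n true `|` Y n false.
  apply/fsetP=> z; rewrite in_act !in_fsetU.
  have := (moves_mem _ _ _).1 mvM z; have := dM z.
  have /fsetP/(_ z) := dXY false false; rewrite !in_fset0 !in_fsetI in_fsetU.
  move: (z \in X n false) (z \in Y n false) (z \in X n true)
    (z \in faces false M) (z \in faces true M).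
  by do 5!case=> //=; move=> ? ? [? ?].
rewrite {}eT in fM; have [_ cT _ _] := fM.
have [|/fsetP dN fN] := fills_glue gZ cT ffN.
  exact: fsubset_trans (moves_border mvN) (fsubsetUr _ _).
have eT : act (X n true `|` Y n false) N = X n true `|` Y n true.
  apply/fsetP=> z; rewrite in_act !in_fsetU.
  have := (moves_mem _ _ _).1 mvN z; have := dN z.
  have /fsetP/(_ z) := dXY true false; rewrite !in_fset0 !in_fsetI in_fsetU.
  move: (z \in X n true) (z \in Y n false) (z \in Y n true)
    (z \in faces false N) (z \in faces true N).
  by do 5!case=> //=; move=> ? ? [? ?].
by rewrite {}eT in fN; apply: fills_comp fM fN.
Qed.

(* For i < n, a composite along degree i of (n+1)-cells is the composite along
   degree n of its two whiskerings, each of which is obtained by gluing. *)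
Lemma comp_is_cell_disjoint (P : hypergraph) (hP : torsion_free_complex P)
    i n (X Y : set_family P) :
    i < n -> is_cell n X -> is_cell n Y -> composable i X Y ->
  is_cell n (comp_family i X Y) /\ X n true `&` Y n true = fset0.
Proof.
(* Disjointness of the tops is carried through the induction because [fills_family_comp] requires it
   one degree lower. *)
elim: n X Y => // n IHn X Y; rewrite ltnS => le_in cX cY [eqXY eqXYi].
have [[eqX X0] capX] := (is_cell_caps _ _).1 cX.
have [[eqY Y0] capY] := (is_cell_caps _ _).1 cY.
pose Z := comp_family i X Y.
suff [dXY fZ] : X n.+1 true `&` Y n.+1 true = fset0 /\
    fills Z (Z n false) (Z n true) (X n.+1 true `|` Y n.+1 true).
  split=> //; apply/is_cell_caps; split.
    split=> [|j e lt_nj]; first by rewrite !comp_family_gt // eqX eqY.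
    by rewrite comp_family_gt ?X0 ?Y0 ?fsetU0 //; apply: leq_ltn_trans (ltnW lt_nj).
  by move=> e; rewrite comp_family_gt //; case: e; rewrite ?eqX ?eqY; apply: fZ.
move: le_in; rewrite leq_eqVlt => /orP[/eqP eq_in|lt_in].
  subst i; have [[cXf cXt mvX ffX] [cYf cYt mvY ffY]] := (capX true, capY true).
  have ZX j e : j < n -> X j e = Z j e by rewrite /Z /comp_family => ->.
  have ZY j e : j < n -> Y j e = Z j e by move=> lt_jn; rewrite -ZX ?eqXY.
  have Zn e : Z n e = if e then Y n e else X n e.
    by rewrite /Z /comp_family ltnn eqxx.
  rewrite !Zn; apply: (fills_comp hP (B := X n true)); first exact: gluing_holds.
    by split=> //; [apply: caps_eq_below cXf|apply: caps_eq_below cXt].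
  by rewrite eqXYi; split=> //; [apply: caps_eq_below cYf|apply: caps_eq_below cYt].
(* Equal signs give the boundaries of the composite; mixed signs serve for disjointness. *)
have IH e e' : is_cell n (comp_family i (bd_family e n X) (bd_family e' n Y)) /\
    X n e `&` Y n e' = fset0.
  rewrite -(bd_family_top e n X true) -(bd_family_top e' n Y true).
  apply: IHn => //;
    [exact: bd_is_cell (ltnSn n) cX|exact: bd_is_cell (ltnSn n) cY|].
  split=> [j e'' lt_ji|]; last by rewrite !bd_family_lt.
  by rewrite !bd_family_lt ?eqXY //; apply: ltn_trans lt_in.
rewrite /Z !(comp_family_gt _ _ _ lt_in); apply: fills_family_comp => // [e|e e'].
  have [_ /(_ true)] := (is_cell_caps _ _).1 (IH e e).1.
  rewrite comp_family_gt // !bd_family_top; apply: caps_eq_below => j e' lt_jn.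
  by rewrite /comp_family !bd_family_lt.
by have [] := IH e e'.
Qed.

Lemma bd_cell_composable (P : hypergraph) i n (lt_in : i < n) (X Y : cell P n) :
  bd_cell true lt_in X = bd_cell false lt_in Y -> composable i X Y.
Proof. by move=> /(congr1 (@cell_val P i)) /bd_composable. Qed.

Lemma comp_is_cell (P : hypergraph) (hP : torsion_free_complex P) i n
    (lt_in : i < n) (X Y : cell P n) :
  bd_cell true lt_in X = bd_cell false lt_in Y -> is_cell n (comp_family i X Y).
Proof.
move=> /bd_cell_composable.
by move/(comp_is_cell_disjoint hP lt_in (cellP X) (cellP Y)) => [].
Qed.

(** * Identities and the laws of a strict omega-category *)

Lemma id_is_cell (P : hypergraph) n (X : set_family P) :
  is_cell n X -> is_cell n.+1 (id_family n X).
Proof.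
move=> [[eqX X0] mvX ffX]; split.
- split=> [|i e lt_ni]; first by rewrite /id_family ltnn.
  by rewrite /id_family leqNgt (ltnW lt_ni).
- move=> i e; rewrite ltnS leq_eqVlt /id_family => /orP[/eqP->|lt_in].
    by rewrite leqnn ltnn eqX /moves !faces0 !fsetU0 !fsetD0.
  by rewrite lt_in (ltnW lt_in); apply: mvX.
- move=> i e; rewrite leq_eqVlt ltnS /id_family => /orP[/eqP->|le_in].
    by rewrite ltnn => u v; rewrite inE.
  by rewrite le_in; apply: ffX.
Qed.

Lemma cell_above (P : hypergraph) n (X : cell P n) i e : n < i -> X i e = fset0.
Proof. by have [[_ X0] _ _] := cellP X; apply: X0. Qed.

Lemma cell_top (P : hypergraph) n (X : cell P n) e e' : X n e = X n e'.
Proof. by have [[eqX _] _ _] := cellP X; case: e; case: e'. Qed.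

(** The family of a cell is already empty above its degree, so identities change the degree and keep
    the family. *)
Lemma id_familyE (P : hypergraph) n (X : cell P n) : id_family n X = X.
Proof.
apply: set_familyP => j e; rewrite /id_family; case: leqP => // lt_nj.
by rewrite cell_above.
Qed.

Definition id_cell (P : hypergraph) n (X : cell P n) : cell P n.+1 :=
  Cell (id_is_cell (cellP X)).

Definition comp_cell (P : hypergraph) (hP : torsion_free_complex P) i n
    (lt_in : i < n) (X Y : cell P n)
    (XY : bd_cell true lt_in X = bd_cell false lt_in Y) : cell P n :=
  Cell (comp_is_cell hP XY).

Lemma iter_id_cell (P : hypergraph) i k (X : cell P i) :
  cell_val (iter_id (G := Cell_globular_set P) (@id_cell P) k X) = X.
Proof. by elim: k => //= k IHk; rewrite id_familyE. Qed.

Lemma cell_eq (P : hypergraph) n (X Y : cell P n) :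
  (forall i e, X i e = Y i e) -> X = Y.
Proof. by move=> eqXY; apply/cell_inj/set_familyP. Qed.

Theorem mainTheorem2 (P : hypergraph) (hP : torsion_free_complex P) :
  exists C : strict_omega_category (Cell_globular_set P),
    (forall n (X : cell P n),
       cell_val (cat_id C X) = id_family n (cell_val X)) /\
    (forall i n (lt_in : (i < n)%N) (X Y : cell P n)
       (XY : bd_cell true lt_in X = bd_cell false lt_in Y),
       cell_val (cat_comp C lt_in X Y XY) =
       comp_family i (cell_val X) (cell_val Y)).
Proof.
(* Cells with equal families are equal, so each law is checked componentwise, by comparing the
   degree of the component with those of the operations. *)
unshelve eexists (@StrictOmegaCategory (Cell_globular_set P) (@id_cell P)
  (@comp_cell P hP) _ _ _ _ _ _ _ _ _); last by split.
- move=> e n lt_nn1 X; apply: cell_eq => i e' /=; rewrite id_familyE /bd_family.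
  by case: ltngtP => [//|lt_ni|->]; [rewrite cell_above|apply: cell_top].
- move=> e j i n lt_ji lt_in lt_jn X Y XY.
  have [eqXY _] := bd_cell_composable XY.
  split; apply: cell_eq => k e' /=; rewrite /bd_family /comp_family;
    case: ltngtP => // [lt_kj|->]; rewrite ?lt_ji ?eqXY //;
    by have lt_ki := ltn_trans lt_kj lt_ji; rewrite lt_ki ?eqXY.
- move=> i n lt_in X Y XY; have [eqXY _] := bd_cell_composable XY.
  split; apply: cell_eq => k e' /=; rewrite /bd_family /comp_family;
    by case: (ltngtP k i) => [lt_ki|//|->]; rewrite ?ltnn ?eqxx // eqXY.
- move=> e i j n lt_ij lt_jn lt_in X Y XY bXY.
  apply: cell_eq => k e' /=; rewrite /bd_family /comp_family.
  case: (ltngtP k j) => [lt_kj|lt_jk|->].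
  + by [].
  + have lt_ik := ltn_trans lt_ij lt_jk.
    by rewrite ltnNge (ltnW lt_ik) (gtn_eqF lt_ik) fsetU0.
  + by rewrite ltnNge (ltnW lt_ij) gtn_eqF.
- move=> i k lt_in X uX; apply: cell_eq => j e /=.
  rewrite /comp_family id_familyE iter_id_cell /= /bd_family.
  by case: ltngtP => // [_|->]; [rewrite fset0U|case: e].
- move=> i k lt_in X uX; apply: cell_eq => j e /=.
  rewrite /comp_family id_familyE iter_id_cell /= /bd_family.
  by case: ltngtP => // [_|->]; [rewrite fsetU0|case: e].
- move=> i n lt_in X Y Z XY YZ XY_Z X_YZ; apply: cell_eq => j e /=.
  by rewrite /comp_family; case: ltngtP => // _; rewrite ?fsetUA //; case: e.
- move=> i j n lt_ij lt_jn lt_in X Y X' Y' XY XY' XX' YY' xy xx.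
  apply: cell_eq => k e /=; rewrite /comp_family.
  case: (ltngtP k j) => [lt_kj|lt_jk|->].
  + by case: ltngtP => // _; case: e.
  + have lt_ik := ltn_trans lt_ij lt_jk.
    by rewrite ltnNge (ltnW lt_ik) (gtn_eqF lt_ik); apply: fsetUACA.
  + by rewrite ltnNge (ltnW lt_ij) gtn_eqF //; case: e.
- move=> i n lt_in lt_in1 X Y XY iXY; apply: cell_eq => j e.
  (* Identities keep families, so both sides are the composite of the families of [X] and [Y]. *)
  rewrite [LHS](f_equal (fun F => F j e) (id_familyE (comp_cell hP XY))) /=.
  by rewrite !id_familyE.
Qed.
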